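(* Let $A$ be a $1$-system annular diagram. Then either $A$ is a cycle (i.e. $A$ contains no squares), or $A$ has a corner on each of its two boundary paths. Equivalently: if $A$ contains at least one square, then each of its boundary paths contains a corner.
   Context: A square complex is a combinatorial 2-complex each of whose 2-cells (squares) is attached along a combinatorial map from a 4-cycle to the 1-skeleton; cubes are $[-1,1]^k$ for $k\le 2$. A midcube of a cube is the subset obtained by setting one coordinate to $0$. Gluing midcubes via the restrictions of the attaching maps gives a complex $U$; a dual curve is a connected component of $U$, it is dual to the edges whose midpoints it contains, and it is an arc if homeomorphic to an interval (possibly of length $0$), simple if its natural immersion into the complex is an embedding. An annular diagram is a finite combinatorial cell decomposition of $S^2$ minus two disjoint open 2-cells; the attaching maps of these two removed 2-cells are the two boundary paths. A (square annular) diagram is an annular diagram that is also a square complex. A $k$-system annular diagram is a square annular diagram whose dual curves are all simple arcs joining the two boundary paths, with any two dual curves intersecting in at most $k$ squares. A corner on a boundary path $P$ is a vertex of $P$ of degree $2$ (number of incident edges, loops counted twice) that is contained in some square. *)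

(* Defs.v *)
(* Annular square diagrams encoded as combinatorial maps
   (rotation systems) on a finite set of darts (half-edges). *)
From mathcomp Require Import all_boot.
Set Implicit Arguments. Unset Strict Implicit. Unset Printing Implicit Defensive.

Section AnnularDiagrams.
Variables (D : finType) (edge node : D -> D) (b1 b2 : D).

(* edge : involution pairing the two darts (sides) of an edge;
   node : rotation of the darts around their common vertex;
   vertices = node-orbits, edges = edge-orbits, 2-cells (faces) = face-orbits. *)
Definition face (d : D) : D := node (edge d).

Definition map_rel : rel D := [rel x y | (y == edge x) || (y == node x)].

(* d lies on the boundary path of the removed 2-cell containing dart b *)
Definition on_bnd (b d : D) : bool := fconnect face b d.

Definition is_square (d : D) : bool := ~~ on_bnd b1 d && ~~ on_bnd b2 d.

(* A (square) annular diagram: a connected combinatorial map of genus 0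
   (Euler characteristic V - E + F = 2, i.e. a cell decomposition of S^2),
   with two distinct distinguished faces (the removed open 2-cells, whose
   face-walks are the two boundary paths) and all other faces of length 4. *)
Definition annular_square_diagram : Prop :=
  [/\ (forall d, edge (edge d) = d) /\ (forall d, edge d != d),
      injective node /\ (forall x y, connect map_rel x y),
      (fcard node (predT : {pred D})) + (fcard face (predT : {pred D}))
        = #|D| %/ 2 + 2,
      ~~ fconnect face b1 b2
    & forall d, is_square d -> order face d = 4].

Definition same_edge (d d' : D) : bool := (d' == d) || (d' == edge d).

Definition opp (d : D) : D := face (face d).

(* The complex U of midcubes: its vertices are the midpoints of the edges,
   and each square with sides d, face d, opp d, face (opp d) contributes two
   midcubes {d, opp d} and {face d, face (opp d)}, the midcube {d, opp d}
   joining the midpoints of the edges of d and of opp d.  Dual curve of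
   (the edge of) a dart d = connected component of U through that edge. *)
Definition curve_rel : rel D :=
  [rel x y | same_edge x y || (is_square x && (y == opp x))].

Definition in_curve (d y : D) : bool := connect curve_rel d y.

(* The dual curve through d is an arc joining the two boundary paths: its
   component of U is a path graph  x_0 -- m_0 -- x_1 -- ... -- m_(k-1) -- x_k
   (edges x_i pairwise distinct, midcubes m_i pairwise distinct, covering all
   edges and all midcubes of the component), and its two end edges x_0, x_k
   lie one on each boundary path. *)
Definition arc_joining_boundaries (d : D) : Prop :=
  exists (k : nat) (x m : nat -> D),
    [/\ (forall i, i < k ->
          [&& is_square (m i), same_edge (x i) (m i)
            & same_edge (x i.+1) (opp (m i))]),
        (forall i j, i <= k -> j <= k -> same_edge (x i) (x j) -> i = j),
        (forall i j, i < k -> j < k ->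
          (m j == m i) || (m j == opp (m i)) -> i = j) /\
        (forall y, in_curve d y -> exists2 i, i <= k & same_edge (x i) y),
        (forall y, in_curve d y -> is_square y ->
          exists2 i, i < k & (y == m i) || (y == opp (m i)))
      & exists y0 y1, [/\ same_edge (x 0) y0, same_edge (x k) y1 &
          (on_bnd b1 y0 && on_bnd b2 y1) || (on_bnd b2 y0 && on_bnd b1 y1)]].

(* The dual curve through d is simple: its immersion in the complex is an
   embedding, i.e. it never contains both midcubes of a square. *)
Definition simple_curve (d : D) : Prop :=
  forall y, in_curve d y -> is_square y -> ~~ in_curve d (face y).

(* number of squares in which the dual curves through d and d' intersect
   (a square, i.e. a face-orbit, is counted through its root) *)
Definition crossing_squares (d d' : D) : {set D} :=
  [set froot face y | y in [pred y | [&& is_square y, in_curve d y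
                                        & in_curve d' (face y)]]].

Definition k_system (k : nat) : Prop :=
  [/\ annular_square_diagram,
      (forall d, arc_joining_boundaries d /\ simple_curve d)
    & forall d d', ~~ in_curve d d' -> #|crossing_squares d d'| <= k].

Definition has_corner (b : D) : Prop :=
  exists d, [/\ on_bnd b d, order node d = 2
                & exists2 y, fconnect node d y & is_square y].

End AnnularDiagrams.

(* Main.v *)
Require Import Defs.
From mathcomp Require Import all_boot.
From mathcomp Require Import ssralg zmodp matrix mxalgebra zify.
(* Suppose that a dual curve m crosses, in its a-th square, another dual curve
   right at the edge e where the latter starts on the boundary P1. Following m
   from P1 to that square and returning to P1 through e gives a closed curve on
   the sphere; let T be the side of it that does not contain P2. As the map has
   genus 0, T is the support of a 0/1 potential on the vertices.
   If a = 0, no curve can start inside T: it would have to leave T to reach P2,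
   and it could only do so through e or the first edge of m. So T contains a
   single vertex, incident to these two edges only, and this is a corner.
   If a > 0, let q be the curve crossing m in its first square. Since q does not
   cross m again, it starts inside T. The same construction for q and the
   first edge of m yields a side strictly contained in T, so one can conclude
   by descent. *)
Set Implicit Arguments. Unset Strict Implicit. Unset Printing Implicit Defensive.

(** * Potentials on maps of genus 0 *)

Section Potential.
Import GRing.Theory.
Local Open Scope ring_scope.

(** The hypothesis confines the left kernel of [A] to the span of the all-ones row, so this kernel
    has dimension at most 1. *)
Lemma rank_ge_pred (K : fieldType) (m n : nat) (A : 'M[K]_(m, n)) :
  (forall u : 'rV_m, u *m A = 0 -> forall i j, u 0 i = u 0 j) ->
  (m.-1 <= \rank A)%N.
Proof.
move=> constA; suff: (\rank (kermx A) <= 1)%N.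
  by rewrite mxrank_ker leq_subLR addn1 -subn1 leq_subLR add1n.
apply: leq_trans (rank_leq_row (const_mx 1 : 'rV[K]_m)); apply: mxrankS.
apply/row_subP => i; have /constA cst: row i (kermx A) *m A = 0.
  by apply/sub_kermxP/row_sub.
apply/sub_rVP; exists (row i (kermx A) 0 i); apply/rowP => j.
by rewrite (cst j i) [RHS]mxE [const_mx _ _ _]mxE mulr1.
Qed.

(** A dimension count: the kernel of [B] contains the row space of [A] and has dimension [n - \rank
    B <= n - p + 1 = m - 1 <= \rank A]. For the coboundary matrices of a connected map, the equation
    on [m], [n], [p] is Euler's formula for the sphere, and the conclusion is that the first
    cohomology vanishes. *)
Lemma exact_of_euler (K : fieldType) (m n p : nat)
    (A : 'M[K]_(m, n)) (B : 'M[K]_(n, p)) :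
  A *m B = 0 -> (m + p = n + 2)%N ->
  (forall u : 'rV_m, u *m A = 0 -> forall i j, u 0 i = u 0 j) ->
  (forall u : 'rV_p, u *m B^T = 0 -> forall i j, u 0 i = u 0 j) ->
  forall w : 'rV_n, w *m B = 0 -> exists u, w = u *m A.
Proof.
move=> AB0 euler /rank_ge_pred rA /rank_ge_pred; rewrite mxrank_tr => rB w wB0.
have sAk : (A <= kermx B)%MS by apply/sub_kermxP.
suff ksA : (kermx B <= A)%MS.
  by apply/submxP/(submx_trans _ ksA)/sub_kermxP.
rewrite -(mxrank_leqif_sup sAk) eqn_leq mxrankS //= mxrank_ker.
by move: (rank_leq_row B) => rB2; clear - rA rB rB2 euler; lia.
Qed.

(** Numbers the orbits, so that vertices, edges and faces can index matrices: [c] gives the orbit of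
    a point, [r] a representative. *)
Lemma orbit_index (T : finType) (f : T -> T) : injective f ->
  exists (c : T -> 'I_(fcard f T)) (r : 'I_(fcard f T) -> T),
    (forall i, c (r i) = i) /\ (forall x y, c x = c y <-> fconnect f x y).
Proof.
move=> injf; have symf := fconnect_sym injf.
pose V := {x : T | froots f x}.
have Vn : #|{: V}| = fcard f T.
  by rewrite card_sig; apply: eq_card => x; rewrite !inE andbT.
pose v x : V := Sub (froot f x) (roots_root symf x).
exists (fun x => cast_ord Vn (enum_rank (v x))).
exists (fun i => val (enum_val (cast_ord (esym Vn) i))); split=> [i|x y].
  rewrite -[RHS](cast_ordKV Vn); congr cast_ord.
  rewrite -[RHS]enum_valK; congr enum_rank; apply: val_inj => /=.
  by case: (enum_val _) => x /= /eqP.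
split=> [/cast_ord_inj/enum_rank_inj/(congr1 val)/= /(rootP symf) // | xy].
by congr (cast_ord _ (enum_rank _)); apply/val_inj/(rootP symf).
Qed.

Variables (D : finType) (edge node : D -> D).
Hypotheses (edgeK : involutive edge) (edgeN : forall d, edge d != d).
Hypothesis node_inj : injective node.
Hypothesis mapC : forall x y, connect (map_rel edge node) x y.
Hypothesis euler : (fcard node D + fcard (face edge node) D = #|D| %/ 2 + 2)%N.

Let face_inj : injective (face edge node).
Proof. by move=> x y /node_inj/(can_inj edgeK). Qed.

Lemma fcard_edge : fcard edge D = (#|D| %/ 2)%N.
Proof.
have inje := can_inj edgeK.
rewrite -(@fcard_order_set _ edge inje 2 D) ?mulnK //.
apply/subsetP => x _; rewrite inE.
have cyc : fcycle edge [:: x; edge x] by rewrite /= !eqxx edgeK eqxx.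
rewrite (order_cycle cyc) ?inE ?eqxx //=.
by rewrite inE eq_sym edgeN.
Qed.

Lemma map_constant (U : Type) (g : D -> U) :
  (forall x, g (edge x) = g x) -> (forall x, g (node x) = g x) ->
  forall x y, g x = g y.
Proof.
move=> ge gn x y; have /connectP[p + ->] := mapC x y.
elim: p x => //= z p IHp x /andP[/orP[]/eqP-> /IHp <-]; by rewrite ?ge ?gn.
Qed.

Lemma F2_addrr (x : 'F_2) : x + x = 0.
Proof. by apply/eqP; case: x => [[|[]]]. Qed.

Lemma F2_addr_eq0 (x y : 'F_2) : x + y = 0 -> y = x.
Proof. by move/(congr1 (+%R x)); rewrite addrA F2_addrr add0r addr0. Qed.

Lemma F2_potential (phi : D -> 'F_2) :
    (forall d, phi (edge d) = phi d) ->
    (forall x, \sum_(d | fconnect (face edge node) x d) phi d = 0) ->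
  exists h : D -> 'F_2, (forall d, h (node d) = h d) /\
    (forall d, h (edge d) = h d + phi d).
Proof.
move=> phiE phi0.
have [v [rv [rvK vP]]] := orbit_index node_inj.
have [e [re [reK eP]]] := orbit_index (can_inj edgeK).
have [f [rf [rfK fP]]] := orbit_index face_inj.
have reE x : re (e x) = x \/ re (e x) = edge x.
  have /eP: e (re (e x)) = e x by rewrite reK.
  rewrite fconnect_sym; last exact: can_inj edgeK.
  have cyc : fcycle edge [:: x; edge x] by rewrite /= !eqxx edgeK eqxx.
  by rewrite (fconnect_cycle cyc) ?inE ?eqxx //= => /orP[]/eqP; auto.
have eE x : e (edge x) = e x.
  by apply/esym/eP/fconnect1.
have vN x : v (node x) = v x by apply/esym/vP/fconnect1.
have fF x : f (face edge node x) = f x by apply/esym/fP/fconnect1.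
(* Mod 2 coboundary matrices, from vertices to edges ([A]) and from edges to faces ([B]). An edge
   contributes one term per dart, so that a loop, or an edge with the same face on both sides,
   cancels. *)
pose A := \matrix_(i, j) (((v (re j) == i)%:R + (v (edge (re j)) == i)%:R) : 'F_2).
pose B := \matrix_(j, k) (((f (re j) == k)%:R + (f (edge (re j)) == k)%:R) : 'F_2).
have sum_delta n (u : 'I_n -> 'F_2) i : \sum_j u j * (i == j)%:R = u i.
  rewrite (bigD1 i) //= eqxx mulr1 big1 ?addr0 // => j.
  by rewrite eq_sym => /negPf->; rewrite mulr0.
have uA (u : 'rV_ _) j : (u *m A) 0 j = u 0 (v (re j)) + u 0 (v (edge (re j))).
  rewrite mxE -!(sum_delta _ (u 0)) -big_split; apply: eq_bigr => i _.
  by rewrite !mxE mulrDr.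
have uB (u : 'rV_ _) j : (u *m B^T) 0 j = u 0 (f (re j)) + u 0 (f (edge (re j))).
  rewrite mxE -!(sum_delta _ (u 0)) -big_split; apply: eq_bigr => i _.
  by rewrite !mxE mulrDr.
(* Each dart accounts for its own side of the edge, hence for one of the two terms in an entry of
   [B]. *)
have sumE (psi : D -> 'F_2) k : (forall d, psi (edge d) = psi d) ->
    \sum_j psi (re j) * B j k = \sum_d psi d * (f d == k)%:R.
  move=> psiE; rewrite (partition_big e predT) //=; apply: eq_bigr => j _.
  rewrite (bigD1 (re j)) /= ?reK // (bigD1 (edge (re j))) /=; last first.
    by rewrite eE reK eqxx edgeN.
  rewrite big1 ?addr0 ?mxE ?psiE ?mulrDr // => x /andP[/andP[/eqP xj nx] nex].
  by case: (reE x); rewrite xj => E; move: nx nex; rewrite E ?edgeK eqxx.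
have AB0 : A *m B = 0.
  apply/matrixP => i k; rewrite [RHS]mxE -[LHS]mul1r.
  pose g x : 'F_2 := (v x == i)%:R.
  rewrite mul1r mxE (eq_bigr (fun j => (g (re j) + g (edge (re j))) * B j k)).
    rewrite (sumE (fun x => g x + g (edge x))); last by move=> d; rewrite edgeK addrC.
    rewrite (eq_bigr (fun x => g x * (f x == k)%:R + g (edge x) * (f x == k)%:R)).
      (* [face x] and [edge x] have the same origin, so reindexing along [face] turns the first sum
         into the second, and the two cancel mod 2. *)
      rewrite big_split /= (reindex_inj face_inj) /=.
      rewrite (eq_bigr (fun x => g (edge x) * (f x == k)%:R)) ?F2_addrr // => x _.
      by rewrite fF /g /face vN.
    by move=> x _; rewrite mulrDl.
  by move=> j _; rewrite [A i j]mxE.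
have [||||u uE] := @exact_of_euler _ _ _ _ A B AB0 _ _ _ (\row_j phi (re j)).
- by rewrite fcard_edge.
(* A function of the vertices that agrees at the two ends of every edge is constant by
   connectedness. The next case is the dual statement for faces. *)
- move=> u u0; have gE x : u 0 (v (edge x)) = u 0 (v x).
    have /rowP/(_ (e x)) := u0; rewrite uA mxE => /F2_addr_eq0.
    by case: (reE x) => ->; rewrite ?edgeK.
  move=> i j; rewrite -(rvK i) -(rvK j).
  by apply: (map_constant (g := fun x => u 0 (v x))) => // x; rewrite vN.
- move=> u u0; have gE x : u 0 (f (edge x)) = u 0 (f x).
    have /rowP/(_ (e x)) := u0; rewrite uB mxE => /F2_addr_eq0.
    by case: (reE x) => ->; rewrite ?edgeK.
  move=> i j; rewrite -(rfK i) -(rfK j).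
  apply: (map_constant (g := fun x => u 0 (f x))) => // x.
  by rewrite -{1}(edgeK x) -/(face edge node (edge x)) fF gE.
- apply/rowP => k; rewrite [RHS]mxE mxE.
  rewrite (eq_bigr (fun j => phi (re j) * B j k)); last by move=> j _; rewrite mxE.
  rewrite sumE // -[RHS](phi0 (rf k)) [RHS]big_mkcond /=; apply: eq_bigr => d _.
  rewrite -[in LHS](rfK k) eq_sym.
  case: eqP => [/fP->|nfd]; first by rewrite mulr1.
  by case: ifP => [/fP//|]; rewrite mulr0.
- exists (fun x => u 0 (v x)); split=> x; first by rewrite vN.
  have /rowP/(_ (e x)) := uE; rewrite uA mxE.
  case: (reE x) => ->; rewrite ?edgeK ?phiE => ->.
    by rewrite addrA F2_addrr add0r.
  by rewrite addrC -addrA F2_addrr addr0.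
Qed.

Lemma potential (phi : D -> bool) :
    (forall d, phi (edge d) = phi d) ->
    (forall x, \big[addb/false]_(d | fconnect (face edge node) x d) phi d = false) ->
  exists h : D -> bool, (forall d, h (node d) = h d) /\
    (forall d, h (edge d) = h d (+) phi d).
Proof.
move=> phiE phi0; pose toF (b : bool) : 'F_2 := b%:R.
have toFD b c : toF (b (+) c) = toF b + toF c by case: b; case: c; apply/eqP.
have toFK : cancel toF (fun x : 'F_2 => x != 0) by case.
have ofK : cancel (fun x : 'F_2 => x != 0) toF.
  by case=> -[|[]] //= ?; apply/eqP.
case: (F2_potential (phi := toF \o phi)).
- by move=> d /=; rewrite phiE.
- by move=> x /=; rewrite -(big_morph toF toFD (erefl : toF false = 0)) phi0.
move=> h [hN hE]; exists (fun d => h d != 0); split=> d; first by rewrite hN.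
by rewrite hE -{1}(ofK (h d)) -toFD toFK.
Qed.

End Potential.

(** * Oriented dual curves *)

Section Arcs.
Variables (D : finType) (edge node : D -> D).
Hypotheses (edgeK : involutive edge) (edgeN : forall d, edge d != d).
Hypothesis node_inj : injective node.
Local Notation face := (face edge node).
Local Notation opp := (Defs.opp edge node).
Local Notation same_edge := (same_edge edge).
Local Notation on := (on_bnd edge node).

(** [opp z] is the opposite side of the square of [z], and [edge] passes to the face beyond it;
    iterating follows a dual curve from square to square. *)
Definition next_dart (z : D) : D := edge (opp z).

(* A dual curve oriented from the boundary [c] to the boundary [c']: it crosses
   the edges of [iter i next_dart y] for [i <= k], and [iter i next_dart y] is
   the dart of the i-th edge on the side of the i-th square. *)
Definition oriented_arc (sq : pred D) (ic : rel D) (c c' y : D) (k : nat) :=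
  [/\ on c (edge y),
      (forall i, i < k -> sq (iter i next_dart y)),
      on c' (iter k next_dart y),
      (forall i j, i <= k -> j <= k ->
         same_edge (iter i next_dart y) (iter j next_dart y) -> i = j)
    & forall z, ic y z -> exists2 i, i <= k & same_edge (iter i next_dart y) z].

Lemma face_inj : injective face.
Proof. by move=> x y /node_inj/(can_inj edgeK). Qed.

Lemma same_edge_sym d d' : same_edge d d' = same_edge d' d.
Proof.
rewrite /Defs.same_edge eq_sym; congr (_ || _).
by apply/eqP/eqP => ->; rewrite edgeK.
Qed.

Lemma same_edgeEl d d' : same_edge (edge d) d' = same_edge d d'.
Proof. by rewrite /Defs.same_edge edgeK orbC. Qed.

Lemma same_edgeEr d d' : same_edge d (edge d') = same_edge d d'.
Proof. by rewrite !(same_edge_sym d) same_edgeEl. Qed.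

Lemma same_edge_trans : transitive same_edge.
Proof.
move=> y x z; rewrite /Defs.same_edge => /orP[]/eqP-> // /orP[]/eqP->;
by rewrite ?edgeK eqxx ?orbT.
Qed.

End Arcs.

(** * Squares and arcs in an annular diagram *)

Section Annulus.
Variables (D : finType) (edge node : D -> D) (b1 b2 : D).
Hypotheses (edgeK : involutive edge) (edgeN : forall d, edge d != d).
Hypothesis node_inj : injective node.
Hypothesis mapC : forall x y, connect (map_rel edge node) x y.
Hypothesis euler : fcard node D + fcard (face edge node) D = #|D| %/ 2 + 2.
Local Notation face := (face edge node).
Local Notation opp := (Defs.opp edge node).
Local Notation same_edge := (same_edge edge).
Local Notation on := (on_bnd edge node).
Local Notation next := (next_dart edge node).
Hypothesis b12 : ~~ fconnect face b1 b2.
(** These stand for [is_square] and [in_curve], whose definitions list the two boundaries in a fixed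
    order. Keeping them abstract lets the section be applied a second time with the boundaries
    exchanged. *)
Variables (sq : pred D) (ic : rel D).
Hypothesis sqE : forall z, sq z = ~~ on b1 z && ~~ on b2 z.
Hypothesis sq4 : forall z, sq z -> order face z = 4.
Hypothesis ic_refl : reflexive ic.
Hypothesis ic_sym : symmetric ic.
Hypothesis ic_trans : transitive ic.
Hypothesis ic_edge : forall z, ic z (edge z).
Hypothesis ic_opp : forall z, sq z -> ic z (opp z).
Hypothesis simple : forall z, sq z -> ~~ ic z (face z).
Hypothesis cross1 : forall y y', sq y -> sq y' -> ic y y' ->
  ic (face y) (face y') -> fconnect face y y'.
Local Notation arc := (oriented_arc edge node sq ic b1 b2).
Hypothesis arcs : forall d, exists y k, arc y k /\ ic d y.
Let symf := fconnect_sym (face_inj edgeK node_inj).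

Lemma sq_face z : sq (face z) = sq z.
Proof. by rewrite !sqE /on_bnd -!(same_fconnect1_r (face_inj edgeK node_inj)). Qed.

Lemma sq_opp z : sq (opp z) = sq z.
Proof. by rewrite !sq_face. Qed.

Lemma face4 z : sq z -> face (face (face (face z))) = z.
Proof. by move=> /sq4 o4; rewrite -[RHS](iter_order (face_inj edgeK node_inj)) o4. Qed.

Lemma oppK z : sq z -> opp (opp z) = z.
Proof. exact: face4. Qed.

Lemma on1_sq z : on b1 z -> sq z = false.
Proof. by rewrite sqE => ->. Qed.

Lemma on2_sq z : on b2 z -> sq z = false.
Proof. by rewrite sqE => ->; rewrite andbF. Qed.

Lemma on12 z : on b1 z -> on b2 z = false.
Proof.
move=> z1; apply: contraNF b12 => z2; apply: connect_trans z1 _.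
by rewrite symf.
Qed.

Lemma ic_edgeE x z : ic x (edge z) = ic x z.
Proof.
apply/idP/idP => xz; first by apply: ic_trans xz _; rewrite ic_sym.
exact: ic_trans xz _.
Qed.

Lemma ic_same x z w : same_edge z w -> ic x w = ic x z.
Proof. by case/orP => /eqP->; rewrite ?ic_edgeE. Qed.

Lemma ic_oppE x z : sq z -> ic x (opp z) = ic x z.
Proof.
move=> sz; apply/idP/idP => xz; last exact: ic_trans xz (ic_opp sz).
by apply: ic_trans xz _; rewrite ic_sym ic_opp.
Qed.

Lemma square_cases z w : sq z -> fconnect face z w ->
  [\/ w = z, w = face z, w = opp z | w = face (opp z)].
Proof.
move=> /sq4 o4; rewrite fconnect_orbit /orbit o4 !inE.
by case/or4P => /eqP->; [apply: Or41|apply: Or42|apply: Or43|apply: Or44].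
Qed.

Lemma square_curve z w : sq z -> fconnect face z w -> ic z w ->
  w = z \/ w = opp z.
Proof.
move=> sz /(square_cases sz)[]-> zw; auto; move: (simple sz); first by rewrite zw.
by rewrite -(ic_oppE z (z := face z)) ?sq_face // zw.
Qed.

Lemma arc_ic y k i : arc y k -> i <= k -> ic y (iter i next y).
Proof.
case=> _ sqy _ _ _; elim: i => [|i IHi] lik; first exact: ic_refl.
by rewrite iterS ic_edgeE ic_oppE ?sqy ?IHi // ltnW.
Qed.

(** A 1-system yields each dual curve in one direction only; reversal supplies the other, so that
    both boundary paths can be treated alike. *)
Lemma arc_rev y k : arc y k ->
  oriented_arc edge node sq ic b2 b1 (edge (iter k next y)) k
  /\ ic y (edge (iter k next y)).
Proof.
move=> A; have [y1 sqy y2 inj cov] := A.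
have yk : ic y (edge (iter k next y)) by rewrite ic_edgeE (arc_ic A).
have rev i : i <= k ->
    iter i next (edge (iter k next y)) = edge (iter (k - i) next y).
  elim: i => [|i IHi] lik; first by rewrite subn0.
  rewrite iterS IHi ?(ltnW lik) // -[k - i]prednK ?subn_gt0 // -subnS.
  by rewrite iterS /next_dart edgeK oppK // sqy // -subSn // subSS leq_subr.
split=> //; split=> [|i lik||i j lik ljk|z yz].
- by rewrite edgeK.
- rewrite rev ?(ltnW lik) // -[k - i]prednK ?subn_gt0 // -subnS iterS edgeK.
  by rewrite sq_opp sqy // -subSn // subSS leq_subr.
- by rewrite rev // subnn.
- rewrite !rev // same_edgeEl // same_edgeEr // => /inj E.
  by rewrite -(subKn lik) -(subKn ljk) E ?leq_subr.
- have [i lik yi] := cov z (ic_trans yk yz).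
  by exists (k - i); rewrite ?leq_subr // rev ?leq_subr // same_edgeEl // subKn.
Qed.

Lemma arc_edge_sq y k i : arc y k -> i < k -> sq (edge (iter i.+1 next y)).
Proof. by case=> _ sqy _ _ _ lik; rewrite iterS edgeK sq_opp sqy. Qed.

Lemma arc_not1 y k i : arc y k -> i <= k -> ~~ on b1 (iter i next y).
Proof.
case=> _ sqy y2 _ _; rewrite leq_eqVlt => /predU1P[->|/sqy]; last first.
  by rewrite sqE => /andP[].
by apply: contraL y2 => /on12->.
Qed.

Lemma arc_edge1 y k i : arc y k -> i <= k -> on b1 (edge (iter i next y)) -> i = 0.
Proof. by case: i => // i A lik /on1_sq; rewrite (arc_edge_sq A lik). Qed.

Lemma arc_edge2 y k i : arc y k -> i <= k -> ~~ on b2 (edge (iter i next y)).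
Proof.
case: i => [|i] A lik; first by case: A => /on12->.
by apply: contraL (arc_edge_sq A lik) => /on2_sq->.
Qed.

(** If the two darts differ, simplicity makes the second one [opp] of the first. This forces
    [j = i.+1], and then [edge] would fix [opp (iter i next y)]. *)
Lemma arc_square_inj y k i j : arc y k -> i < k -> j < k ->
  fconnect face (iter i next y) (iter j next y) -> i = j.
Proof.
move=> A lik ljk yij; case: (A) => _ sqy _ inj _.
have ici l : l < k -> ic y (iter l next y) by move=> ?; rewrite (arc_ic A) // ltnW.
have [|E|E] := square_curve (sqy i lik) yij.
- by apply: ic_trans (ici j ljk); rewrite ic_sym ici.
- by apply: inj; rewrite ?(ltnW lik) ?(ltnW ljk) // E /Defs.same_edge eqxx.
have Ej : i.+1 = j.
  by apply: inj; rewrite ?(ltnW ljk) // E iterS /Defs.same_edge edgeK eqxx orbT.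
by move: E (edgeN (opp (iter i next y))); rewrite -Ej iterS /next_dart => ->;
  rewrite eqxx.
Qed.

(** * Loops along a dual curve and their sides *)

(* The edges crossed by the closed curve that goes along the arc of [y] from
   the boundary to its [a]-th square and comes back to the boundary through
   the edge of [e]. *)
Definition crossed y a e (z : D) : bool :=
  (\big[addb/false]_(j < a.+1) same_edge (iter j next y) z) (+) same_edge e z.

(** [e] is a side of the [a]-th square on the other dual curve through it, and the far side of its
    edge is on the boundary of [b1]: the other curve has its end there. *)
Definition loop y k a e : Prop :=
  [/\ arc y k, a < k, e = face (iter a next y) \/ e = face (opp (iter a next y))
    & on b1 (edge e)].

(* [h] is the indicator function of the side of the loop that avoids [b2], read at
   the origins of the darts. *)
Definition side_of y a e (h : D -> bool) : Prop :=
  [/\ forall z, h (node z) = h z, forall z, h (edge z) = h z (+) crossed y a e z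
    & h b2 = false].

Lemma crossed_edge y a e z : crossed y a e (edge z) = crossed y a e z.
Proof.
rewrite /crossed same_edgeEr //; congr (_ (+) _).
by apply: eq_bigr => i _; rewrite same_edgeEr.
Qed.

Lemma face_sum_edge x w :
  \big[addb/false]_(d | fconnect face x d) same_edge w d
    = fconnect face x w (+) fconnect face x (edge w).
Proof.
rewrite big_mkcond (bigD1 w) //= (bigD1 (edge w)) ?edgeN //= big1 ?addbF.
  by rewrite /Defs.same_edge !eqxx orbT; do 2!case: ifP.
by move=> z /andP[/negPf zw /negPf zew]; rewrite /Defs.same_edge zw zew if_same.
Qed.

Section Loop.
Variables (y : D) (k a : nat) (e : D).
Hypothesis L : loop y k a e.

Let A : arc y k. Proof. by case: L. Qed.
Let ak : a < k. Proof. by case: L. Qed.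
Let sqa : sq (iter a next y). Proof. by case: A => _ sqy _ _ _; apply: sqy. Qed.

Lemma loop_sq : sq e.
Proof. by case: L => _ _ [->|->] _; rewrite !sq_face. Qed.

Lemma loop_face : fconnect face (iter a next y) e.
Proof.
by case: L => _ _ [->|->] _; [exact: (fconnect_iter _ 1) | exact: (fconnect_iter _ 3)].
Qed.

Lemma loop_nic : ~~ ic y e.
Proof.
have ya := arc_ic A (ltnW ak); apply: contra (simple sqa) => ye.
have : ic (iter a next y) e by apply: ic_trans ye; rewrite ic_sym.
case: L => _ _ [->|->] _ //.
by rewrite -[face (opp _)]/(opp (face _)) ic_oppE ?sq_face.
Qed.

Lemma loop_face_cases : face e = iter a next y \/ face e = opp (iter a next y).
Proof. by case: L => _ _ [->|->] _; [right | left; rewrite face4]. Qed.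

Lemma loop_face_ic : ic y (face e).
Proof. by case: loop_face_cases => ->; rewrite ?ic_oppE // (arc_ic A) // ltnW. Qed.

(** The loop is closed, so it enters each face as often as it leaves it. Consecutive edges of the
    arc share a square, so the sum telescopes to the boundary face of [b1] and the [a]-th square,
    which are also the two faces along [e]. *)
Lemma crossed_sum x :
  \big[addb/false]_(d | fconnect face x d) crossed y a e d = false.
Proof.
rewrite /crossed big_split /= face_sum_edge exchange_big /=.
under eq_bigr do rewrite face_sum_edge.
have -> : \big[addb/false]_(j < a.+1) (fconnect face x (iter j next y)
    (+) fconnect face x (edge (iter j next y)))
  = fconnect face x (edge y) (+) fconnect face x (iter a next y).
  elim: a => [|i IHi]; first by rewrite big_ord_recr big_ord0 /= addbC.
  rewrite big_ord_recr /= IHi -[next_dart _ _ _]/(edge (opp (iter i next y))) edgeK.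
  rewrite /Defs.opp -!(same_fconnect1_r (face_inj edgeK node_inj)).
  by do 3!case: (fconnect _ _ _).
have -> : fconnect face x e = fconnect face x (iter a next y).
  exact/esym/(same_connect_r symf)/loop_face.
have -> : fconnect face x (edge e) = fconnect face x (edge y).
  case: L => -[y1 _ _ _ _] _ _ e1; apply: (same_connect_r symf).
  by apply: connect_trans y1; rewrite symf.
by rewrite [X in _ (+) X]addbC addbb.
Qed.

Lemma crossed_arc i : i <= k -> crossed y a e (iter i next y) = (i <= a).
Proof.
move=> lik; rewrite /crossed.
have -> : same_edge e (iter i next y) = false.
  apply: contraNF loop_nic => ei.
  by rewrite -(ic_same y ei) (arc_ic A).
case: A => _ _ _ inj _.
rewrite addbF; case: leqP => [lia|lai].
  have lia' : i < a.+1 by [].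
  rewrite (bigD1 (Ordinal lia')) //= big1 ?addbF; first by rewrite /Defs.same_edge eqxx.
  move=> j; apply: contraNF => ji; apply/eqP/val_inj/inj => //.
  by apply: leq_trans (ltnW ak); rewrite -ltnS ltn_ord.
rewrite big1 // => j _; apply/negP => ji; have lja : j <= a by rewrite -ltnS ltn_ord.
by move: lai; rewrite -(inj _ _ (leq_trans lja (ltnW ak)) lik ji) ltnNge lja.
Qed.

Lemma crossed_end : crossed y a e e.
Proof.
rewrite /crossed big1 ?[same_edge _ _]/Defs.same_edge ?eqxx // => j _.
apply: contraNF loop_nic => je; rewrite (ic_same y je) (arc_ic A) //.
by apply: leq_trans (ltnW ak); rewrite -ltnS ltn_ord.
Qed.

Lemma crossedP z : crossed y a e z ->
  (exists2 i, i <= a & same_edge (iter i next y) z) \/ same_edge e z.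
Proof.
rewrite /crossed; case: (same_edge e z); [by right | rewrite addbF => H; left].
have [/existsP[i yi]|/existsPn no] :=
  boolP [exists i : 'I_a.+1, same_edge (iter i next y) z].
  by exists i => //; rewrite -ltnS ltn_ord.
by move: H; rewrite big1 // => i _; apply/negbTE/no.
Qed.

(** If the crossed edge is on the arc, the curve of [y] also contains the opposite side [face w]; if
    it is the return edge, the dart must be [e] itself, since [edge e] lies in no square. *)
Lemma crossed_lateral w : sq w -> crossed y a e (face (opp w)) ->
  ic y (face w) \/ w = face e.
Proof.
move=> sw /crossedP[[i lia yi]|/orP[]/eqP E].
- left; rewrite -(ic_oppE y (z := face w)) ?sq_face //.
  rewrite (ic_same y yi) (arc_ic A) //; exact: leq_trans lia (ltnW ak).
- by right; rewrite -E face4.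
- case: L => _ _ _; rewrite -E => /on1_sq; by rewrite sq_face sq_opp sw.
Qed.

Lemma ex_side : exists h, side_of y a e h.
Proof.
have [||h [hN hE]] :=
  potential edgeK edgeN node_inj mapC euler (phi := crossed y a e).
- exact: crossed_edge.
- exact: crossed_sum.
(* Adding the constant [h b2] selects the side that avoids [b2]. *)
exists (fun z => h z (+) h b2); split=> [z|z|]; first by rewrite hN.
  by rewrite hE addbAC.
by rewrite addbb.
Qed.

Variable h : D -> bool.
Hypothesis H : side_of y a e h.

Lemma side_face z : h (face z) = h z (+) crossed y a e z.
Proof. by case: H => hN hE _; rewrite /Defs.face hN hE. Qed.

Lemma side_edge z : h (edge z) = h (face z).
Proof. by case: H => hN _ _; rewrite /Defs.face hN. Qed.

(** Every dart of a crossed edge lies in a square or on the boundary of [b1], so the walk around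
    [b2] never changes side. *)
Lemma side_on2 z : on b2 z -> h z = false.
Proof.
case: H => _ _ h2 /iter_findex <-; elim: (findex _ _ _) => //= n IHn.
rewrite side_face IHn; apply/negbTE/negP => /crossedP.
have z2 : on b2 (iter n face b2) by apply: fconnect_iter.
case=> [[i lia]|]; move=> /orP[]/eqP E; rewrite E in z2.
- by move/on2_sq: z2; case: A => _ -> //; apply: leq_ltn_trans ak.
- have /negP := arc_edge2 A (leq_trans lia (ltnW ak)); exact.
- by move/on2_sq: z2; rewrite loop_sq.
- by case: L => _ _ _ /on12; rewrite z2.
Qed.

Lemma side_next z : sq z -> h (next z) = h (face (opp z)).
Proof. by move=> sz; rewrite side_edge. Qed.

Lemma side_step z : sq z -> h z = h (next z) (+) crossed y a e (face (opp z)).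
Proof. by move=> sz; rewrite side_next // -{1}(face4 sz) side_face. Qed.

(** The arc ends on [b2], hence outside, so it has to leave. The origins of consecutive darts are
    joined by a lateral side of the square, and it leaves where that side is crossed. *)
Lemma side_arc y' k' j : arc y' k' -> j <= k' -> h (iter j next y') ->
  exists i, [/\ j <= i, i < k' & crossed y a e (face (opp (iter i next y')))].
Proof.
case=> _ sqy y2 _ _ /subnKC; move: (k' - j) => n; elim: n j => [|n IHn] j Ek hj.
  by move: hj; rewrite side_on2 // -[j]addn0 Ek.
have ljk : j < k' by rewrite -Ek -addSnnS leq_addr.
have [Cj|nCj] := boolP (crossed y a e (face (opp (iter j next y')))).
  by exists j; split.
have hj1 : h (iter j.+1 next y').
  by move: hj; rewrite side_step ?sqy // (negPf nCj) addbF.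
have Ek1 : j.+1 + n = k' by rewrite addSnnS.
have [i [lji lik Ci]] := IHn _ Ek1 hj1.
by exists i; split=> //; apply: ltnW.
Qed.

(** If it were inside, the arc would have to leave later, in a square where it crosses itself,
    against simplicity, or along [e], which only happens in the [a]-th square. *)
Lemma side_past j : a < j -> j <= k ->
  h (iter j next y) = false /\ h (edge (iter j next y)) = false.
Proof.
move=> laj ljk; have h0 : h (iter j next y) = false.
  apply/negbTE/negP => /(side_arc A ljk)[i [lji lik]].
  have sqi : sq (iter i next y) by case: A => _ ->.
  have yi := arc_ic A (ltnW lik).
  case/(crossed_lateral sqi) => [yf|E].
    by move/negP: (simple sqi); apply; apply: ic_trans yf; rewrite ic_sym.
  have Eai : a = i.
    apply: (arc_square_inj A ak lik); rewrite E.
    exact: connect_trans loop_face (fconnect1 _ _).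
  by move: laj; rewrite Eai ltnNge lji.
by case: H => _ hE _; rewrite hE h0 crossed_arc // leqNgt laj.
Qed.

End Loop.

(** * Corners from loops that end in the first square *)

Definition corner : Prop :=
  exists d, [/\ on b1 d, order node d = 2 & exists2 z, fconnect node d z & sq z].

(** [edge u] and [w] are consecutive around their vertex. Callers only know that [node w] is one of
    these two darts; [node w = w] is excluded by injectivity of [node]. *)
Lemma corner_at u w : sq w -> on b1 (edge u) -> w = face u ->
    w != edge u -> (node w = w \/ node w = edge u) -> corner.
Proof.
move=> sw u1 wE wu nw; exists (edge u); split=> //; last first.
  by exists w => //; rewrite wE; apply: fconnect1.
have nwu : node w = edge u.
  by case: nw => // E; case/eqP: wu; apply: node_inj (etrans E wE).
have cyc : fcycle node [:: edge u; w] by rewrite /= nwu !eqxx wE !eqxx.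
by rewrite (order_cycle cyc) ?inE ?eqxx //= inE eq_sym wu.
Qed.

Lemma dart_arc z : exists y k j,
  [/\ arc y k, j <= k & z = iter j next y \/ z = edge (iter j next y)].
Proof.
have [y [k [A zy]]] := arcs z; have [_ _ _ _ cov] := A.
have [j ljk /orP[]/eqP->] := cov z (etrans (ic_sym _ _) zy); exists y, k, j; split; auto.
Qed.

(** Every dart is on an arc up to reversal, and reversal changes [h] only on crossed edges. *)
Lemma side_inside z y k a e h : loop y k a e -> side_of y a e h ->
  (forall y' k' j, arc y' k' -> j <= k' -> h (iter j next y') ->
     crossed y a e (iter j next y')) ->
  h z -> crossed y a e z.
Proof.
move=> L H inside; have [y' [k' [j [A ljk [->|->]]]]] := dart_arc z.
  exact: (inside _ _ _ A ljk).
have [_ hE _] := H; rewrite hE crossed_edge.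
by case C: (crossed _ _ _ _) => //; rewrite addbF => /(inside _ _ _ A ljk); rewrite C.
Qed.

Lemma loop_corner y k e : loop y k 0 e -> corner.
Proof.
move=> L; have [h H] := ex_side L; have [A k0 eE e1] := L.
have sqe := loop_sq L; have y1 : on b1 (edge y) by case: A.
have sqy : sq y by case: A => _ /(_ 0 k0).
have ey : e = y \/ e = edge y -> False.
  by move=> E; move/negP: (loop_nic L); apply; case: E => ->; rewrite ?ic_edgeE.
have Cy : crossed y 0 e y by rewrite (crossed_arc L (i := 0)).
have inside z : h z -> crossed y 0 e z.
  apply: (side_inside L H) => y' k' j A' ljk hj.
  have [i [lji lik Ci]] := side_arc L H A' ljk hj.
  have sqi : sq (iter i next y') by case: A' => _ ->.
  (* An arc can leave only through the square of [y], along one of its two curves. If it leaves from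
     the boundary edge, it has just started, so [i = j = 0]; it cannot leave towards that edge
     ([stop]), as it never returns to [b1]. *)
  have start w : on b1 (edge w) -> crossed y 0 e w -> iter i next y' = w ->
      crossed y 0 e (iter j next y').
    move=> w1 Cw E; have i0 : i = 0.
      by apply: (arc_edge1 A' (ltnW lik)); rewrite E.
    by move: lji E; rewrite i0 leqn0 => /eqP-> ->.
  have stop w : sq w -> on b1 (edge w) -> iter i next y' <> opp w.
    move=> sw w1 E; move/negP: (arc_not1 A' lik); apply.
    by rewrite iterS /next_dart E oppK.
  have Ce := crossed_end L.
  have fy : face (opp (iter i next y')) = y -> iter i next y' = face y.
    by move=> <-; rewrite face4.
  case/crossedP: Ci => [[l]|]; rewrite ?leqn0.
    move=> /eqP-> /=; rewrite /Defs.same_edge => /orP[]/eqP E.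
      have {}E := fy E; case: eE => /= eE.
        by apply: (start e) => //; rewrite E.
      by case: (stop e) => //; rewrite E eE /Defs.opp !face4 ?sq_face.
    by move/on1_sq: y1; rewrite -E sq_face sq_opp sqi.
  case/orP=> /eqP E; last by move/on1_sq: e1; rewrite -E sq_face sq_opp sqi.
  have {}E : iter i next y' = face e by rewrite -E face4.
  case: eE => /= eE; last by apply: (start y) => //; rewrite E eE face4.
  by case: (stop y) => //; rewrite E eE.
have [h1 he1] := side_past L H (ltnSn 0) k0.
rewrite /= /next_dart edgeK in h1 he1.
have [hN hE _] := H.
have crossed_yP z : crossed y 0 e z -> same_edge y z \/ same_edge e z.
  by case/crossedP=> [[l]|]; rewrite ?leqn0; [move/eqP-> |]; auto.
have nyo : y <> opp y.
  by move=> yo; move/negP: (arc_not1 A (i := 1) k0); apply; rewrite /= /next_dart -yo.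
have hne z w : (forall v, same_edge y v \/ same_edge e v -> h v -> v = z \/ v = w) ->
    h z -> node z = z \/ node z = w.
  move=> zw hz; have hnz : h (node z) by rewrite hN.
  exact: zw (crossed_yP _ (inside _ hnz)) hnz.
have := side_face H e; rewrite (crossed_end L) => hfe.
case: eE => /= eE.
(* The inner vertex is the end of [y], where [edge y] and [e] meet. *)
- have he : h e by move: hfe; rewrite {1}eE -[face (face y)]/(opp y) he1; case: (h e).
  have hy : h y = false.
    rewrite (side_step H sqy) h1; apply/negP => /(crossed_lateral L sqy)[yf|].
      by move/negP: (simple sqy).
    by rewrite eE; apply: nyo.
  apply: (@corner_at y e) => //; first by apply/eqP => E; apply: ey; right.
  apply: (hne _ _ _ he) => v [] /orP[]/eqP-> hv; auto; move: hv; first by rewrite hy.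
  by rewrite (side_edge H) hfe he.
(* Mirror case: the inner vertex is the origin of [y], where [edge e] and [y] meet. *)
- have he : h e = false by rewrite eE -(side_edge H) h1.
  have fe : face e = y by rewrite eE face4.
  have hy : h y by move: hfe; rewrite fe he.
  have hey : h (edge y) = false.
    rewrite (side_edge H); have := side_face H (face y).
    rewrite -[face (face y)]/(opp y) he1.
    case: (h (face y)) => // /esym/negbFE/crossed_yP[yf|/orP[]/eqP yf].
    - by move/negP: (simple sqy); rewrite (ic_same y yf).
    - by case: nyo; apply: (face_inj edgeK node_inj); rewrite yf.
    - by move/on1_sq: e1; rewrite -yf sq_face sqy.
  apply: (@corner_at e y) => //.
    by apply/eqP => E; apply: ey; right; rewrite E edgeK.
  apply: (hne _ _ _ hy) => v [] /orP[]/eqP-> hv; auto; move: hv; last by rewrite he.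
  by rewrite hey.
Qed.

(** * Descent *)

Lemma loop_step y k a e h : loop y k a.+1 e -> side_of y a.+1 e h ->
  exists y' k' b h',
    [/\ loop y' k' b y, side_of y' b y h' & #|[pred z | h' z]| < #|[pred z | h z]|].
Proof.
move=> L H; have [A ak eE e1] := L; have [_ hE _] := H.
have sqe := loop_sq L; have y1 : on b1 (edge y) by case: A.
have k0 : 0 < k by apply: leq_ltn_trans ak.
have sqy : sq y by case: A => _ /(_ 0 k0).
have lat w : fconnect face y w -> ~~ ic y w -> crossed y a.+1 e w = false.
  move=> yw; apply: contraNF => /(crossedP)[[i lia yi]|/orP[]/eqP E].
  - by rewrite (ic_same y yi) (arc_ic A) // (leq_trans lia) // ltnW.
  - have/(arc_square_inj A k0 ak) // : fconnect face y (iter a.+1 next y).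
    by apply: connect_trans yw _; rewrite E symf (loop_face L).
  - by move/on1_sq: e1; rewrite -E sqE /on_bnd -!(same_connect_r symf yw) -sqE sqy.
have nyf : ~~ ic y (face y) by apply: simple.
have nyfo : ~~ ic y (face (opp y)).
  by rewrite -[face (opp y)]/(opp (face y)) ic_oppE ?sq_face.
have f1 : fconnect face y (face y) by apply: fconnect1.
have f3 : fconnect face y (face (opp y)) by apply: (fconnect_iter _ 3).
have Cy : crossed y a.+1 e y by rewrite (crossed_arc L (i := 0)).
(* [l] is the lateral side of the first square at whichever end of [y] is inside. It is not crossed,
   so both its ends are inside. *)
have [l [[sql yl lE nyl] [[hl hel] lc]]] : exists l,
  [/\ sq l, fconnect face y l, y = face l \/ y = face (opp l) & ~~ ic y l]
  /\ (h l /\ h (edge l)) /\ (if h y then l = face (opp y) else l = face y).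
  case hy: (h y).
    have hl : h (face (opp y)).
      by rewrite -(addbF (h _)) -(lat _ f3 nyfo) -(side_face H) face4 // hy.
    exists (face (opp y)); split; last by rewrite hE hl lat.
    by split=> //; [rewrite sq_face sq_opp | left; rewrite face4].
  have hl : h (face y) by rewrite (side_face H) hy Cy.
  exists (face y); split; last by rewrite hE hl lat.
  by split=> //; [rewrite sq_face | right; rewrite -[LHS](face4 sqy)].
have C0 := lat l yl nyl.
have [y' [k' [j [A' ljk lE']]]] := dart_arc l.
have ly' : ic l y'.
  have := arc_ic A' ljk; rewrite ic_sym; apply: ic_trans.
  by case: lE' => {1}->; rewrite ?ic_refl // ic_sym ic_edgeE.
have lcurve i : i <= k' -> ic l (iter i next y').
  by move=> lik; apply: ic_trans ly' (arc_ic A' lik).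
have lface : ic y (face l).
  by case: (h y) lc => ->; rewrite ?face4 // -/(opp y) ic_oppE.
(* The curves of [l] and [y] cross in the square of [y], hence only there. *)
have cross w : sq w -> ic l w -> ic y (face w) -> fconnect face l w.
  move=> sw lw yw; apply: cross1 => //; apply: ic_trans yw.
  by rewrite ic_sym.
have disj i : i <= k' -> ~~ ic y (iter i next y').
  move=> lik; apply: contra nyl => yi; apply: ic_trans yi _.
  by rewrite ic_sym lcurve.
have [_ sqy' y'2 inj' _] := A'.
have notfe i : i < k' -> iter i next y' <> face e.
  move=> lik E; move/negP: (disj i (ltnW lik)); apply.
  by rewrite E (loop_face_ic L).
(* The arc enters the square of [y] through [l]. If it came out there instead, it would continue
   inside and could leave only by crossing [y] again. *)
have {}lE' : l = iter j next y'.
  case: lE' => // lE'.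
  have hj : h (iter j next y') by rewrite -(edgeK (iter j next y')) -lE'.
  have [i [lji lik Ci]] := side_arc L H A' ljk hj.
  have sqi := sqy' i lik.
  case: (crossed_lateral L sqi Ci) => [yi|/(notfe i lik)//].
  have liy := lcurve i (ltnW lik).
  case: (square_curve sql (cross _ sqi liy yi) liy) => E.
    have Eij : i = j.
      by apply: inj'; rewrite ?(ltnW lik) // E lE' /Defs.same_edge edgeK eqxx orbT.
    by case/eqP: (edgeN l); rewrite {1}lE' edgeK -Eij E.
  have Eij : i.+1 = j.
    apply: inj' => //; rewrite iterS /next_dart E oppK // lE' edgeK.
    by rewrite /Defs.same_edge eqxx.
  by move: lji; rewrite -Eij ltnn.
have {ljk} ljk : j < k'.
  move: ljk; rewrite leq_eqVlt => /predU1P[Ej|//].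
  by move/on2_sq: y'2; rewrite -Ej -lE' sql.
have L' : loop y' k' j y.
  split=> //; rewrite -lE'; case: (h y) lc => ->; first by left; rewrite face4.
  by right; rewrite -[LHS](face4 sqy).
have [h' H'] := ex_side L'; have [_ hE' _] := H'.
have fl w : fconnect face l w -> fconnect face y w by apply: connect_trans.
(* To leave the new side, the arc of [y] would have to cross the curve of [l] after its first
   square. *)
have y_out i : 0 < i -> i <= k ->
    h' (iter i next y) = false /\ h' (edge (iter i next y)) = false.
  move=> i0 lik; have hi : h' (iter i next y) = false.
    apply/negP => /(side_arc L' H' A lik)[n [lin lnk]].
    have sqn : sq (iter n next y) by case: A => _ ->.
    have yn := arc_ic A (ltnW lnk).
    case/(crossed_lateral L' sqn) => [y'n|E]; last first.
      by move/negP: nyf; rewrite -E.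
    have : fconnect face l (face (iter n next y)).
      apply: cross; rewrite ?sq_face ?(ic_trans ly') //.
      by rewrite -/(opp (iter n next y)) ic_oppE.
    move/fl; rewrite -(same_fconnect1_r (face_inj edgeK node_inj)).
    by move/(arc_square_inj A k0 lnk) => n0; move: lin; rewrite -n0 leqNgt i0.
  split=> //; rewrite hE' hi; apply/negP => /crossedP[[n lnj]|] E.
    move/negP: (disj n (leq_trans lnj (ltnW ljk))); apply.
    by rewrite -(ic_same y E) (arc_ic A).
  case: A => _ _ _ inj _.
  by move: i0; rewrite -(inj 0 i).
(* The ends of [e] are ends of the two edges of the arc of [y] around the [a.+1]-th square. *)
have e_out : h' e = false /\ h' (edge e) = false.
  have [ya eya] := y_out a.+1 isT (ltnW ak); have [yb eyb] := y_out a.+2 isT ak.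
  rewrite !(side_edge H') in eya *.
  rewrite iterS /next_dart edgeK in yb eyb; rewrite (side_edge H') in yb.
  by case: eE => ->; rewrite ?face4 //; case: A => _ ->.
(* Going back from [l] to the boundary, a change of side would be a crossing with [y] in an earlier
   square. *)
have below n : n <= j -> h (iter (j - n) next y').
  elim: n => [|n IHn] lnj; first by rewrite subn0 -lE'.
  have ljn : j - n.+1 < k' by rewrite (leq_ltn_trans (leq_subr _ _)).
  rewrite (side_step H) ?sqy' //.
  have -> : next (iter (j - n.+1) next y') = iter (j - n) next y'.
    by rewrite -iterS -subSn // subSS.
  rewrite IHn ?(ltnW lnj) //; apply/negP => /(crossed_lateral L (sqy' _ ljn)).
  case=> [yn|/(notfe _ ljn)//].
  have := cross _ (sqy' _ ljn) (lcurve _ (ltnW ljn)) yn; rewrite lE'.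
  by move/(arc_square_inj A' ljk ljn) => E; clear - E lnj; lia.
have in_y' z n : n <= j -> same_edge (iter n next y') z -> h z /\ h (edge z).
  move=> lnj; have hn : h (iter n next y') by rewrite -(subKn lnj) below ?leq_subr.
  have lnk := leq_trans lnj (ltnW ljk).
  have Cn : crossed y a.+1 e (iter n next y') = false.
    apply/negP => /crossedP[[i lia yi]|en].
      move/negP: (disj n lnk); apply.
      by rewrite (ic_same y yi) (arc_ic A) // (leq_trans lia) // ltnW.
    (* Otherwise the two curves would also cross in the [a.+1]-th square. *)
    have le : ic l e by rewrite -(ic_same l en) lcurve.
    have /fl ye := cross _ sqe le (loop_face_ic L).
    have : fconnect face y (iter a.+1 next y).
      by apply: connect_trans ye _; rewrite symf (loop_face L).
    by move/(arc_square_inj A k0 ak).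
  have hen : h (edge (iter n next y')) by rewrite hE hn Cn.
  by case/orP=> /eqP->; rewrite ?edgeK.
have Col : crossed y' j y (opp l) = false.
  rewrite -(edgeK (opp l)) lE' crossed_edge -[edge _]/(iter j.+1 next y').
  by rewrite (crossed_arc L') // ltnn.
have Cy' : crossed y' j y y by apply: crossed_end L'.
(* Both loops use the edge of [y]. The far edge of its square is outside the new side, and the
   lateral side [opp l] is not crossed by the new loop, which determines [h'] at the ends of [y]. *)
have hy' : h' y = h y.
  have [z1 ez1] := y_out 1 isT k0; rewrite /= /next_dart edgeK in z1 ez1.
  rewrite (side_edge H') in z1.
  case hy: (h y) lc => lc; rewrite lc in Col.
    have Cf : crossed y' j y (face y) = false.
      by rewrite -Col -[opp _]/(face (face (face (face (face y))))) face4 ?sq_face.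
    have := side_face H' (face y); rewrite -[face (face y)]/(opp y) ez1 Cf addbF.
    by rewrite -(side_edge H') hE' Cy'; case: (h' y).
  by rewrite -{1}(face4 sqy) (side_face H') z1 -[face _]/(opp (face y)).
have hey' : h' (edge y) = h (edge y) by rewrite hE hE' Cy Cy' hy'.
(* The predicate [h' && ~~ h] takes equal values at the two ends of every edge, crossed or not, so
   by connectedness it has everywhere its value at [b2]. *)
have sub z : h' z -> h z.
  suff: h' z && ~~ h z = false by case: (h' z); case: (h z).
  have [_ _ h2] := H'.
  transitivity (h' b2 && ~~ h b2); last by rewrite h2.
  apply: (map_constant mapC (g := fun z => h' z && ~~ h z)) => {}z; last first.
    by have [-> _ _] := H; have [-> _ _] := H'.
  have [C'z|C'z] := boolP (crossed y' j y z).
    case/crossedP: C'z => [[n lnj yn]|/orP[]/eqP->].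
    - by have [-> ->] := in_y' z n lnj yn; rewrite !andbF.
    - by rewrite hy' hey' !andbN.
    - by rewrite edgeK hy' hey' !andbN.
  have [Cz|Cz] := boolP (crossed y a.+1 e z).
    case/crossedP: Cz => [[[|n] lna yn]|/orP[]/eqP->].
    - by case/orP: yn => /eqP->; rewrite ?edgeK hy' hey' !andbN.
    - have [yn0 yn1] := y_out n.+1 isT (leq_trans lna (ltnW ak)).
      move: (iter n.+1 next y) yn yn0 yn1 => w /orP[]/eqP-> w0 w1;
      by rewrite ?edgeK w0 w1.
    - by case: e_out => -> ->.
    - by rewrite edgeK; case: e_out => -> ->.
  by rewrite hE hE' (negPf Cz) (negPf C'z) !addbF.
exists y', k', j, h'; split=> //; apply/proper_card/properP; split.
  by apply/subsetP => z; rewrite !inE; apply: sub.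
(* Strictness: the new loop crosses [l], so only one end of [l] is in the new side, while both are
   in the old one. *)
have : h' (edge l) = h' l (+) true.
  by rewrite hE' lE' (crossed_arc L') ?(ltnW ljk) // leqnn.
case hl': (h' l) => /= hel'.
  by exists (edge l); rewrite inE ?hel'.
by exists l; rewrite inE ?hl'.
Qed.

Lemma loop_has_corner y k a e : loop y k a e -> corner.
Proof.
move=> L; have [h H] := ex_side L.
elim/ltn_ind: {h}#|_| {-2}h (erefl #|[pred z | h z]|) y k a e L H
  => n IHn h En y k a e L H.
case: a L H => [|a] L H; first exact: loop_corner L.
have [y' [k' [b [h' [L' H' lt]]]]] := loop_step L H.
by apply: (IHn _ _ h' (erefl _) _ _ _ _ L' H'); rewrite -En.
Qed.

(** Let [y] start the curve of [z]. The loop follows the other curve through the first square of [y]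
    and returns through [y]; the two cases are the directions in which that curve traverses this
    square. *)
Lemma square_corner z : sq z -> corner.
Proof.
move=> sz; have [y [k [j [A ljk zE]]]] := dart_arc z.
have k0 : 0 < k.
  case: k A ljk => // A; rewrite leqn0 => /eqP j0; rewrite j0 /= in zE.
  case: A => y1 _ y2 _ _.
  by case: zE sz => ->; [rewrite on2_sq | rewrite on1_sq].
have [y1 sqy _ _ _] := A; have {sqy} sqy : sq y by apply: (sqy 0 k0).
have sqf : sq (face y) by rewrite sq_face.
have [y' [k' [i [A' lik [fE|fE]]]]] := dart_arc (face y).
  move: lik; rewrite leq_eqVlt => /predU1P[Ei|lik].
    by case: A' => _ _ + _ _; rewrite -Ei -fE => /on2_sq; rewrite sqf.
  apply: (@loop_has_corner y' k' i y); split=> //.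
  by right; rewrite -fE -[LHS](face4 sqy).
case: i lik fE => [|i] lik fE.
  by case: A' => + _ _ _ _; rewrite -[y']/(iter 0 next y') -fE => /on1_sq; rewrite sqf.
apply: (@loop_has_corner y' k' i y); split=> //; left.
have <- : opp (face y) = iter i next y'.
  by rewrite fE iterS edgeK oppK //; case: A' => _ ->.
by rewrite -[LHS](face4 sqy).
Qed.

End Annulus.

(** * Application to 1-systems *)

Section OneSystem.
Variables (D : finType) (edge node : D -> D) (b1 b2 : D).
Hypothesis K : k_system edge node b1 b2 1.
Local Notation face := (face edge node).
Local Notation opp := (Defs.opp edge node).
Local Notation same_edge := (same_edge edge).
Local Notation on := (on_bnd edge node).
Local Notation next := (next_dart edge node).
Local Notation sq := (is_square edge node b1 b2).
Local Notation ic := (in_curve edge node b1 b2).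

Let edgeK : involutive edge. Proof. by case: K => -[[]]. Qed.
Let edgeN d : edge d != d. Proof. by case: K => -[[]]. Qed.
Let node_inj : injective node. Proof. by case: K => -[_ []]. Qed.
Let mapC x y : connect (map_rel edge node) x y. Proof. by case: K => -[_ []]. Qed.
Let euler : fcard node D + fcard face D = #|D| %/ 2 + 2.
Proof. by case: K => -[]. Qed.
Let b12 : ~~ fconnect face b1 b2. Proof. by case: K => -[]. Qed.
Let sq4 z : sq z -> order face z = 4. Proof. by case: K => -[_ _ _ _ sq4] _ _ /sq4. Qed.
Let symf := fconnect_sym (face_inj edgeK node_inj).

Let sqE z : sq z = ~~ on b1 z && ~~ on b2 z. Proof. by []. Qed.

Lemma in_curve_sym : symmetric ic.
Proof.
apply: sym_connect_sym => x y; rewrite /curve_rel /= same_edge_sym //.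
congr (_ || _); apply/andP/andP => -[sz /eqP->].
  by rewrite (sq_opp edgeK node_inj sqE) sz (oppK edgeK node_inj sq4).
by rewrite (sq_opp edgeK node_inj sqE) sz (oppK edgeK node_inj sq4).
Qed.

Let in_curve_refl : reflexive ic. Proof. exact: connect0. Qed.
Let in_curve_trans : transitive ic. Proof. exact: connect_trans. Qed.

Lemma in_curve_edge z : ic z (edge z).
Proof. by apply: connect1; rewrite /curve_rel /= /Defs.same_edge eqxx orbT. Qed.

Lemma in_curve_opp z : sq z -> ic z (opp z).
Proof. by move=> sz; apply: connect1; rewrite /curve_rel /= sz eqxx orbT. Qed.

Lemma curve_simple z : sq z -> ~~ ic z (face z).
Proof. by case: K => _ + _ => /(_ z)[_ ]; apply; apply: connect0. Qed.

Lemma curves_cross_once y y' : sq y -> sq y' -> ic y y' ->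
  ic (face y) (face y') -> fconnect face y y'.
Proof.
move=> sy sy' yy' fyy'; have [_ _ K1] := K.
have /card_le1_eqP eqc := K1 y (face y) (curve_simple sy).
apply/(rootP symf)/eqc; apply/imsetP.
  by exists y'; rewrite // inE sy' yy'.
by exists y; rewrite // inE sy /in_curve !connect0.
Qed.

(** The midcubes are automatically coherently directed: [m i.+1] and [opp (m i)] lie on the same
    edge and differ because the midcubes are distinct, so [m i.+1] is [next (m i)]. *)
Lemma oriented_arcs d (c c' : D) (x m : nat -> D) (k : nat) (y0 y1 : D) :
    (forall z, on c z -> ~~ sq z /\ ~~ on c' z) -> (forall z, on c' z -> ~~ sq z) ->
    (forall i, i < k -> [&& sq (m i), same_edge (x i) (m i)
                          & same_edge (x i.+1) (opp (m i))]) ->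
    (forall i j, i <= k -> j <= k -> same_edge (x i) (x j) -> i = j) ->
    (forall i j, i < k -> j < k -> (m j == m i) || (m j == opp (m i)) -> i = j) ->
    (forall y, ic d y -> exists2 i, i <= k & same_edge (x i) y) ->
    same_edge (x 0) y0 -> same_edge (x k) y1 -> on c y0 -> on c' y1 ->
  exists y, oriented_arc edge node sq ic c c' y k /\ ic d y.
Proof.
move=> cP c'P xm xinj minj cov x0 xk cy0 cy1.
(* An arc of length 0 has no midcube; its only dart must be the one on [c']. *)
pose y := if k == 0 then y1 else m 0.
have same z w v : same_edge z w -> same_edge z v -> v = w \/ v = edge w.
  move=> zw zv; have : same_edge w v.
    by apply: (same_edge_trans edgeK) zv; rewrite same_edge_sym.
  by case/orP=> /eqP; auto.
have ym i : i < k -> iter i next y = m i.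
  elim: i => [|i IHi] lik; first by rewrite /= /y; case: (k) lik.
  rewrite iterS IHi ?(ltnW lik) //.
  have /and3P[_ _ xi] := xm i (ltnW lik); have /and3P[_ xi1 _] := xm i.+1 lik.
  case: (same _ _ _ xi xi1) => E; last by rewrite E.
  have /n_Sn[] : i = i.+1 by apply: minj; rewrite ?(ltnW lik) // E eqxx orbT.
have xy i : i <= k -> same_edge (x i) (iter i next y).
  case: i => [_|i lik].
    rewrite /= /y; case: posnP => [k0|k0]; first by rewrite -{1}k0.
    by case/and3P: (xm 0 k0).
  by rewrite iterS ym // same_edgeEr //; case/and3P: (xm i lik).
have icy i : i <= k -> ic y (iter i next y).
  elim: i => [|i IHi] lik; first exact: connect0.
  apply: connect_trans (IHi (ltnW lik)) _; rewrite iterS ym //.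
  case/and3P: (xm i lik) => sm _ _.
  exact: connect_trans (in_curve_opp sm) (in_curve_edge _).
have dy : ic d y.
  have [i lik xi] := cov d (connect0 _ _).
  rewrite in_curve_sym; apply: connect_trans (icy i lik) _.
  by case: (same _ _ _ (xy i lik) xi) => ->; [apply: connect0 | apply: in_curve_edge].
exists y; split=> //; split.
- case: (same _ _ _ (xy 0 (leq0n k)) x0) => E; last by rewrite -E.
  rewrite E /= /y in cy0; case: posnP cy0 => k0 /cP[ns n'].
    by rewrite cy1 in n'.
  by case/and3P: (xm 0 k0) => sm; rewrite sm in ns.
- by move=> i lik; rewrite ym //; case/and3P: (xm i lik).
- case: (same _ _ _ (xy k (leqnn k)) xk) => E; first by rewrite -E.
  have [k0|k0] := posnP k.
    by case/eqP: (edgeN y1); rewrite {2}E k0 /= /y k0.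
  have lk : k.-1 < k by rewrite prednK.
  have Ek : iter k next y = edge (opp (m k.-1)) by rewrite -{1}(prednK k0) iterS ym.
  case/and3P: (xm _ lk) => sm _ _; move/negP: (c'P _ cy1); case.
  by rewrite E Ek edgeK (sq_opp edgeK node_inj sqE).
- move=> i j lik ljk E; apply: xinj => //.
  apply: (same_edge_trans edgeK) (xy i lik) _.
  apply: (same_edge_trans edgeK) E _.
  by rewrite same_edge_sym // xy.
- move=> z yz; have [i lik xi] := cov z (connect_trans dy yz).
  exists i => //; apply: (same_edge_trans edgeK) xi.
  by rewrite same_edge_sym // xy.
Qed.

Lemma on_b1 z : on b1 z -> ~~ sq z /\ ~~ on b2 z.
Proof. by move=> z1; rewrite (on1_sq sqE) // (on12 edgeK node_inj b12). Qed.

Lemma on_b2 z : on b2 z -> ~~ sq z /\ ~~ on b1 z.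
Proof.
by move=> z2; rewrite (on2_sq sqE) //; split=> //; apply: contraL z2 => /on_b1[].
Qed.

Let b21 : ~~ fconnect face b2 b1. Proof. by rewrite symf. Qed.
Let sqE' z : sq z = ~~ on b2 z && ~~ on b1 z. Proof. by rewrite andbC. Qed.

Lemma arcs_both_ways d :
  (exists y k, oriented_arc edge node sq ic b1 b2 y k /\ ic d y) /\
  (exists y k, oriented_arc edge node sq ic b2 b1 y k /\ ic d y).
Proof.
have [_ arcK _] := K; have [arc _] := arcK d.
have [k [x [m [xm xinj [minj cov] _ [y0 [y1 [x0 xk E]]]]]]] := arc.
case/orP: E => /andP[cy0 cy1].
  have [y [A dy]] := oriented_arcs on_b1 (fun z h => proj1 (on_b2 h))
    xm xinj minj cov x0 xk cy0 cy1.
  split; first by exists y, k.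
  have [A' yy'] := arc_rev edgeK node_inj sqE sq4 in_curve_refl
    in_curve_sym in_curve_trans in_curve_edge in_curve_opp A.
  by exists (edge (iter k next y)), k; split=> //; apply: connect_trans yy'.
have [y [A dy]] := oriented_arcs on_b2 (fun z h => proj1 (on_b1 h))
    xm xinj minj cov x0 xk cy0 cy1.
split; last by exists y, k.
have [A' yy'] := arc_rev edgeK node_inj sqE' sq4 in_curve_refl
    in_curve_sym in_curve_trans in_curve_edge in_curve_opp A.
by exists (edge (iter k next y)), k; split=> //; apply: connect_trans yy'.
Qed.

Lemma square_corners z : sq z ->
  has_corner edge node b1 b2 b1 /\ has_corner edge node b1 b2 b2.
Proof.
move=> sz; have arcs12 d := proj1 (arcs_both_ways d).
have arcs21 d := proj2 (arcs_both_ways d); split.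
  exact: (square_corner edgeK edgeN node_inj mapC euler b12 sqE sq4 in_curve_refl
    in_curve_sym in_curve_trans in_curve_edge in_curve_opp curve_simple
    curves_cross_once arcs12 sz).
exact: (square_corner edgeK edgeN node_inj mapC euler b21 sqE' sq4 in_curve_refl
  in_curve_sym in_curve_trans in_curve_edge in_curve_opp curve_simple
  curves_cross_once arcs21 sz).
Qed.

End OneSystem.

Theorem theorem1p4 (D : finType) (edge node : D -> D) (b1 b2 : D) :
  k_system edge node b1 b2 1 ->
  (forall d, ~~ is_square edge node b1 b2 d) \/
  (has_corner edge node b1 b2 b1 /\ has_corner edge node b1 b2 b2).
Proof.
move=> K.
have [/existsP[z sz]|/existsPn] := boolP [exists d, is_square edge node b1 b2 d].
  by right; apply: square_corners sz.
by left.
Qed.
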